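(* Let $(X,\mathcal{U})$ be a uniform space, equipped with its uniform topology. If $X$ is countably compact, then $X$ is a Baire space.
   Context: A uniform structure (uniformity) on a nonempty set $X$ is a filter $\mathcal{U}$ on $X\times X$, whose elements are called entourages, such that: every $U\in\mathcal{U}$ contains the diagonal $\Delta=\{(x,x):x\in X\}$; if $U\in\mathcal{U}$ then $U^{-1}=\{(y,x):(x,y)\in U\}\in\mathcal{U}$; and for each $U\in\mathcal{U}$ there is $V\in\mathcal{U}$ with $V\circ V\subset U$, where $V\circ V=\{(x,y):\exists z\in X,\ (x,z)\in V,\ (z,y)\in V\}$. A uniform space is not assumed to be separated (Hausdorff). For $U\in\mathcal{U}$ and $x\in X$ put $U[x]=\{y\in X:(x,y)\in U\}$. The uniform topology $\mathcal{T}_{\mathcal{U}}$ on $X$ is the one in which $A\subset X$ is open if and only if for each $x\in A$ there is $U\in\mathcal{U}$ with $U[x]\subset A$; topological properties of a uniform space refer to this topology. A topological space is countably compact if every countable open cover has a finite subcover. A topological space is a Baire space if every countable intersection of dense open sets is dense. *)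

(* Defs.v *)
From HB Require Import structures.
From mathcomp Require Import all_boot all_order all_algebra finmap.
From mathcomp Require Import all_classical.
From mathcomp Require Import topology.

Set Implicit Arguments.
Unset Strict Implicit.
Unset Printing Implicit Defensive.

Local Open Scope classical_set_scope.

(* [countable] is "at most countable", so finite families are allowed in both
   definitions. *)
Definition countably_compact (T : topologicalType) (A : set T) : Prop :=
  forall C : set (set T), countable C -> (forall O, C O -> open O) ->
    A `<=` cover C id -> finite_subset_cover C id A.

Definition baire_space (T : topologicalType) : Prop :=
  forall C : set (set T), countable C -> (forall O, C O -> open O /\ dense O) ->
    dense (\bigcap_(O in C) O).

(* Main.v *)
Require Import Defs.
From mathcomp Require Import all_boot all_order all_algebra finmap.
From mathcomp Require Import all_classical.
From mathcomp Require Import topology.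

Local Open Scope classical_set_scope.

(** A uniform space is regular, so inside any nonempty open set one can nest
    nonempty open sets [V n] with the closure of [V n.+1] contained in
    [V n] and in the [n]-th dense open set. Countable compactness gives a point
    in all these closures. *)

(** If the intersection were empty, the complements of the [F n] would form a countable open cover,
    and a finite subcover would miss every point of some [F n] with [n] large. *)
Lemma countably_compact_nested (T : topologicalType) (F : nat -> set T) :
  countably_compact [set: T] -> (forall n, closed (F n)) ->
  (forall n, F n !=set0) -> (forall n, F n.+1 `<=` F n) ->
  \bigcap_n F n !=set0.
Proof.
move=> ccT clF F0 Fdec.
have Fmono m n : (m <= n)%N -> F n `<=` F m.
  move=> /subnK <-; elim: (n - m)%N => // k IHk.
  by rewrite addSn; apply: subset_trans (Fdec _) IHk.
apply/set0P/eqP => F_eq0.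
pose C := range (fun n => ~` F n).
have Ccount : countable C by apply: card_le_trans (card_image_le _ _) _.
have Copen O : C O -> open O by move=> [n _ <-]; exact: closed_openC.
have Ccover : [set: T] `<=` cover C id.
  move=> x _; have : ~ (\bigcap_n F n) x by rewrite F_eq0.
  move=> /existsNP[n /not_implyP[_ nFx]].
  by exists (~` F n) => //; exists n.
have [D DC Dcover] := ccT C Ccount Copen Ccover.
(* The subcover consists of sets, so [g] recovers an index for each; the value [0] outside [C] is a
   dummy. *)
have /choice[g gP] (O : set T) : exists n, C O -> ~` F n = O.
  by have [[n _ <-]|nCO] := pselect (C O); [exists n | exists 0%N].
have [x Fx] := F0 (\max_(O <- D) g O)%N.
have [O /= OD Ox] := Dcover x I.
have := Ox; rewrite -(gP O (set_mem (DC O OD))); apply.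
by apply: Fmono Fx; apply: leq_bigmax_seq.
Qed.

Lemma regular_open_shrink (T : topologicalType) (U : set T) :
  regular_space T -> open U -> U !=set0 ->
  exists V : set T, [/\ open V, V !=set0 & closure V `<=` U].
Proof.
move=> regT oU [x Ux].
have [B Bx BU] := regT x U (open_nbhs_nbhs (conj oU Ux)).
(* The neighbourhood [B] need not be open, hence the interior. *)
exists B°; split; [exact: open_interior | by exists x |].
exact: subset_trans (closureS (@interior_subset _ B)) BU.
Qed.

Lemma regular_countably_compact_baire (T : topologicalType) :
  regular_space T -> countably_compact [set: T] -> baire_space T.
Proof.
move=> regT ccT C cC CP U U0 oU.
(* Either [C] is empty, or [e] enumerates it by all of [nat], possibly with repetitions. *)
have [->|[e]] := pfcard_geP cC; first by rewrite bigcap_set0 setIT.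
have eP n : open (e n) /\ dense (e n) by apply: CP; exact: funS.
(* The hypothesis on [s.2] sits under the existential so that choice yields a total function of the
   stage and the current set. *)
have step (s : nat * set T) : exists V : set T,
    open s.2 /\ s.2 !=set0 ->
    [/\ open V, V !=set0 & closure V `<=` s.2 `&` e s.1].
  have [[os s0]|ns] := pselect (open s.2 /\ s.2 !=set0); last by exists set0.
  have [oe de] := eP s.1.
  have [V VP] := regular_open_shrink T _ regT (openI os oe) (de _ s0 os).
  by exists V.
have [f fP] := choice step.
pose V := fix V n := if n is k.+1 then f (k, V k) else U.
have VP n : open (V n) /\ V n !=set0.
  by elim: n => [//|n IHn]; have [] := fP (n, V n) IHn.
have VS n : closure (V n.+1) `<=` V n `&` e n by have [] := fP (n, V n) (VP n).
have [|||x Fx] := countably_compact_nested T (fun n => closure (V n)) ccT.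
- by move=> n; exact: closed_closure.
- by move=> n; have [_ [x Vx]] := VP n; exists x; exact: subset_closure.
- by move=> n x /VS[Vx _]; exact: subset_closure.
(* Uses the closure of index [n.+1]; the case [n = 0] puts [x] in [U]. *)
have {}Fx n : V n x /\ e n x by apply: VS; exact: Fx.
exists x; split; first by have [] := Fx 0%N.
by move=> O /(@surj _ _ _ _ e)[n _ <-]; have [] := Fx n.
Qed.

Theorem theorem3p3 (X : uniformType) (X_neq0 : [set: X] !=set0)
  (X_cc : countably_compact [set: X]) : baire_space X.
Proof. exact: regular_countably_compact_baire uniform_regular X_cc. Qed.
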